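(* Let $\mathfrak g$ be a Lie algebra with a complex structure $J$ and assume that $\mathfrak g$ decomposes into a direct sum of vector spaces $\mathfrak g=\mathfrak k\oplus J\mathfrak k$, where $J\mathfrak k$ is an ideal in $\mathfrak g$. Then $\mathfrak h:=J\mathfrak k$ is either 2-step nilpotent or abelian, and $J$ is induced from a 1-cocycle $j\in Z^1(\mathfrak k,\pi)$ of maximal rank, if $\mathfrak k$ is equipped with the Lie bracket of $\mathfrak g/\mathfrak h$ and $\pi$ is a representation from $\mathfrak k$ into $\mathfrak h$ by derivations.
   Context: Lie algebras are real and finite-dimensional. A complex structure on $\mathfrak g$ is a linear map $J:\mathfrak g\to\mathfrak g$ with $J^2=-1$ and $[Jx,Jy]=[x,y]+J[Jx,y]+J[x,Jy]$ for all $x,y\in\mathfrak g$. Here $\mathfrak k$ is a linear subspace; it is given the Lie bracket $[\cdot,\cdot]_{\mathfrak k}$ transported from $\mathfrak g/\mathfrak h$ by the linear isomorphism $\mathfrak k\to\mathfrak g/\mathfrak h$, and $\pi(x)y=[x,y]$ for $x\in\mathfrak k$, $y\in\mathfrak h$. $Z^1(\mathfrak k,\pi)$ denotes the linear maps $j:\mathfrak k\to\mathfrak h$ with $\pi(x)j(y)-\pi(y)j(x)-j([x,y]_{\mathfrak k})=0$ for all $x,y\in\mathfrak k$ (1-cocycles). Maximal rank means invertible. That $J$ is induced from $j$ means $J(x,y)=(-j^{-1}y,jx)$ for $x\in\mathfrak k$, $y\in\mathfrak h$, with respect to $\mathfrak g=\mathfrak k\oplus\mathfrak h$ (so $j=J|_{\mathfrak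 k}$). *)

(* Defs.v *)
From HB Require Import structures.
From mathcomp Require Import all_boot all_algebra.
From mathcomp Require Import reals.
Set Implicit Arguments.
Unset Strict Implicit.
Unset Printing Implicit Defensive.
Import GRing.Theory.
Local Open Scope ring_scope.
Local Open Scope quotient_scope.

(* Lie brackets are unbundled from the carrier, since a subspace may carry a
   bracket that is not the restriction of the ambient one. *)
Record lie_bracket (F : fieldType) (V : lmodType F) := LieBracket {
  lie_op :> V -> V -> V;
  lie_linearl : forall (a : F) (x y z : V),
    lie_op (a *: x + y) z = a *: lie_op x z + lie_op y z;
  lie_linearr : forall (a : F) (x y z : V),
    lie_op z (a *: x + y) = a *: lie_op z x + lie_op z y;
  lie_alt : forall x : V, lie_op x x = 0;
  lie_jacobi : forall x y z : V,
    lie_op x (lie_op y z) + lie_op y (lie_op z x) + lie_op z (lie_op x y) = 0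
}.

Section VectorQuotient.
Variables (F : fieldType) (V : vectType F) (U : {vspace V}).

Definition vquot : Type := Quotient.quot (pred_of_vspace U).
HB.instance Definition _ := GRing.Zmodule.on vquot.

Definition vquot_pi (x : V) : vquot := \pi_(Quotient.quot (pred_of_vspace U)) x.
Definition vquot_repr (a : vquot) : V := repr (a : Quotient.quot (pred_of_vspace U)).

Lemma vquot_reprK : cancel vquot_repr vquot_pi.
Proof. exact: reprK. Qed.

Lemma vquot_eqP x y : reflect (vquot_pi x = vquot_pi y) (x - y \in U).
Proof.
have := Quotient.idealrBE (pred_of_vspace U) x y.
rewrite /vquot_pi; move=> ->.
exact: eqP.
Qed.

Lemma vquot_piD : {morph vquot_pi : x y / x + y}.
Proof. exact: Quotient.pi_add. Qed.

Definition vquot_scale (a : F) (u : vquot) := vquot_pi (a *: vquot_repr u).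

Lemma vquot_piZ a x : vquot_pi (a *: x) = vquot_scale a (vquot_pi x).
Proof.
apply/vquot_eqP; rewrite -scalerBr memvZ //.
by apply/vquot_eqP; rewrite vquot_reprK.
Qed.

Fact vquot_scaleA a b v :
  vquot_scale a (vquot_scale b v) = vquot_scale (a * b) v.
Proof. by rewrite -[v]vquot_reprK -!vquot_piZ scalerA. Qed.
Fact vquot_scale1 : left_id 1 vquot_scale.
Proof. by move=> v; rewrite -[v]vquot_reprK -!vquot_piZ scale1r. Qed.
Fact vquot_scaleDr : right_distributive vquot_scale +%R.
Proof.
move=> a u v; rewrite -[u]vquot_reprK -[v]vquot_reprK.
by rewrite -vquot_piD -!vquot_piZ -vquot_piD scalerDr.
Qed.
Fact vquot_scaleDl v : {morph vquot_scale^~ v : a b / a + b}.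
Proof.
by move=> a b; rewrite -[v]vquot_reprK -!vquot_piZ scalerDl vquot_piD.
Qed.
HB.instance Definition _ := GRing.Zmodule_isLmodule.Build F vquot
  vquot_scaleA vquot_scale1 vquot_scaleDr vquot_scaleDl.

Fact vquot_pi_linear : linear vquot_pi.
Proof. by move=> a x y; rewrite vquot_piD vquot_piZ. Qed.
HB.instance Definition _ := GRing.isLinear.Build F V vquot _ vquot_pi
  vquot_pi_linear.

End VectorQuotient.

Section Brackets.
Variables (F : fieldType) (V : vectType F) (br : lie_bracket V).

Lemma lieDl x y z : br (x + y) z = br x z + br y z.
Proof. by have := lie_linearl br 1 x y z; rewrite !scale1r. Qed.
Lemma lieDr x y z : br z (x + y) = br z x + br z y.
Proof. by have := lie_linearr br 1 x y z; rewrite !scale1r. Qed.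
Lemma lieN x y : br x y = - br y x.
Proof.
have := lie_alt br (x + y).
rewrite lieDl !lieDr !lie_alt add0r addr0 => /eqP.
by rewrite addr_eq0 => /eqP.
Qed.
Lemma lieNl x z : br (- x) z = - br x z.
Proof.
have H := lieDl x (- x) z; rewrite subrr in H.
have H0 : br 0 z = 0 by have := lieDl 0 0 z; rewrite addr0 => /esym/eqP;
  rewrite -subr_eq0 addrK => /eqP.
by move: H; rewrite H0 => /esym/eqP; rewrite addrC addr_eq0 => /eqP.
Qed.
Lemma lieNr x z : br z (- x) = - br z x.
Proof. by rewrite lieN lieNl -lieN. Qed.
Lemma lieBl x y z : br (x - y) z = br x z - br y z.
Proof. by rewrite lieDl lieNl. Qed.
Lemma lieBr x y z : br z (x - y) = br z x - br z y.
Proof. by rewrite lieDr lieNr. Qed.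

Definition is_ideal (h : {vspace V}) : Prop :=
  forall x y : V, y \in h -> br x y \in h.

Section Ideal.
Variables (h : {vspace V}) (hI : is_ideal h).

Lemma ideal_subl x y : x \in h -> br x y \in h.
Proof. by move=> hx; rewrite lieN memvN hI. Qed.

Definition ideal_op (x y : subvs_of h) : subvs_of h :=
  vsproj h (br (vsval x) (vsval y)).

Lemma ideal_opE x y : vsval (ideal_op x y) = br (vsval x) (vsval y).
Proof. by rewrite /ideal_op vsprojK ?hI ?subvsP. Qed.

Fact ideal_op_linearl a x y z :
  ideal_op (a *: x + y) z = a *: ideal_op x z + ideal_op y z.
Proof. by apply: subvs_inj; rewrite linearP /= !ideal_opE linearP lie_linearl. Qed.
Fact ideal_op_linearr a x y z :
  ideal_op z (a *: x + y) = a *: ideal_op z x + ideal_op z y.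
Proof. by apply: subvs_inj; rewrite linearP /= !ideal_opE linearP lie_linearr. Qed.
Fact ideal_op_alt x : ideal_op x x = 0.
Proof. by apply: subvs_inj; rewrite ideal_opE lie_alt linear0. Qed.
Fact ideal_op_jacobi x y z :
  ideal_op x (ideal_op y z) + ideal_op y (ideal_op z x)
    + ideal_op z (ideal_op x y) = 0.
Proof. by apply: subvs_inj; rewrite !linearD /= !ideal_opE lie_jacobi. Qed.

Definition ideal_bracket : lie_bracket (subvs_of h) :=
  LieBracket ideal_op_linearl ideal_op_linearr ideal_op_alt ideal_op_jacobi.

Definition quot_op (a b : vquot h) : vquot h :=
  vquot_pi h (br (vquot_repr a) (vquot_repr b)).

Lemma quot_opE x y :
  quot_op (vquot_pi h x) (vquot_pi h y) = vquot_pi h (br x y).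
Proof.
apply/vquot_eqP; set x' := vquot_repr _; set y' := vquot_repr _.
have hx : x' - x \in h by apply/vquot_eqP; rewrite vquot_reprK.
have hy : y' - y \in h by apply/vquot_eqP; rewrite vquot_reprK.
have -> : br x' y' - br x y = br (x' - x) y' + br x (y' - y).
  by rewrite lieBl lieBr addrA subrK.
by apply: memvD; [apply: ideal_subl | apply: hI].
Qed.

Fact quot_op_linearl a x y z :
  quot_op (a *: x + y) z = a *: quot_op x z + quot_op y z.
Proof.
rewrite -[x]vquot_reprK -[y]vquot_reprK -[z]vquot_reprK.
by rewrite -linearP !quot_opE lie_linearl linearP.
Qed.
Fact quot_op_linearr a x y z :
  quot_op z (a *: x + y) = a *: quot_op z x + quot_op z y.
Proof.
rewrite -[x]vquot_reprK -[y]vquot_reprK -[z]vquot_reprK.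
by rewrite -linearP !quot_opE lie_linearr linearP.
Qed.
Fact quot_op_alt x : quot_op x x = 0.
Proof. by rewrite -[x]vquot_reprK quot_opE lie_alt linear0. Qed.
Fact quot_op_jacobi x y z :
  quot_op x (quot_op y z) + quot_op y (quot_op z x)
    + quot_op z (quot_op x y) = 0.
Proof.
rewrite -[x]vquot_reprK -[y]vquot_reprK -[z]vquot_reprK.
by rewrite !quot_opE -!linearD /= lie_jacobi linear0.
Qed.

Definition quot_bracket : lie_bracket (vquot h) :=
  LieBracket quot_op_linearl quot_op_linearr quot_op_alt quot_op_jacobi.

End Ideal.
End Brackets.

Section Transport.
Variables (F : fieldType) (V W : lmodType F) (bW : lie_bracket W).
Variables (f : {linear V -> W}) (g : W -> V) (fK : cancel f g) (gK : cancel g f).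

Definition transport_op (x y : V) : V := g (bW (f x) (f y)).

Lemma transport_opE x y : f (transport_op x y) = bW (f x) (f y).
Proof. exact: gK. Qed.

Fact transport_linearl a x y z :
  transport_op (a *: x + y) z = a *: transport_op x z + transport_op y z.
Proof.
by apply: (can_inj fK); rewrite linearP !transport_opE linearP lie_linearl.
Qed.
Fact transport_linearr a x y z :
  transport_op z (a *: x + y) = a *: transport_op z x + transport_op z y.
Proof.
by apply: (can_inj fK); rewrite linearP !transport_opE linearP lie_linearr.
Qed.
Fact transport_alt x : transport_op x x = 0.
Proof. by apply: (can_inj fK); rewrite transport_opE lie_alt linear0. Qed.
Fact transport_jacobi x y z :
  transport_op x (transport_op y z) + transport_op y (transport_op z x)
    + transport_op z (transport_op x y) = 0.
Proof.
by apply: (can_inj fK); rewrite !linearD !transport_opE lie_jacobi linear0.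
Qed.

Definition transport_bracket : lie_bracket V :=
  LieBracket transport_linearl transport_linearr transport_alt transport_jacobi.

End Transport.

Definition direct_decomposition (F : fieldType) (V : vectType F)
    (k h : {vspace V}) : Prop :=
  (k + h = fullv)%VS /\ directv (k + h).

Section Complement.
Variables (F : fieldType) (V : vectType F) (br : lie_bracket V).
Variables (k h : {vspace V}).
Hypotheses (kh : direct_decomposition k h) (hI : is_ideal br h).

Definition compl_to_quot (x : subvs_of k) : vquot h := vquot_pi h (vsval x).

Fact compl_to_quot_linear : linear compl_to_quot.
Proof. by move=> a x y; rewrite /compl_to_quot !linearP. Qed.
HB.instance Definition _ := GRing.isLinear.Build F (subvs_of k) (vquot h) _
  compl_to_quot compl_to_quot_linear.

Definition quot_to_compl (a : vquot h) : subvs_of k :=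
  vsproj k (daddv_pi k h (vquot_repr a)).

Lemma quot_to_complK : cancel quot_to_compl compl_to_quot.
Proof.
case: kh => khT /directv_addP khD a.
rewrite /compl_to_quot /quot_to_compl vsprojK ?memv_pi //.
rewrite -[RHS]vquot_reprK; apply/vquot_eqP; rewrite -memvN opprB.
have := daddv_pi_add khD (_ : vquot_repr a \in (k + h)%VS).
rewrite khT memvf => /(_ isT) {1}<-.
by rewrite addrAC subrr add0r memv_pi.
Qed.

Lemma compl_to_quotK : cancel compl_to_quot quot_to_compl.
Proof.
case: (kh) => khT /directv_addP khD x; apply: subvs_inj.
apply/eqP; rewrite -subr_eq0 -memv0 -khD memv_cap rpredB ?subvsP //=.
by apply/vquot_eqP; apply: quot_to_complK.
Qed.

(* [., .]_k, transported along k -> g / h *)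
Definition compl_bracket : lie_bracket (subvs_of k) :=
  transport_bracket (quot_bracket hI) compl_to_quotK quot_to_complK.

Lemma compl_bracketE x y :
  vquot_pi h (vsval (compl_bracket x y)) = vquot_pi h (br (vsval x) (vsval y)).
Proof. by rewrite -(quot_opE hI); apply: quot_to_complK. Qed.

End Complement.

Section AdjointAction.
Variables (F : fieldType) (V : vectType F) (br : lie_bracket V).
Variables (k h : {vspace V}).

(* pi(x) y = [x, y]; see ad_actionE *)
Definition ad_action (x : subvs_of k) : 'End(subvs_of h) :=
  linfun (fun y : subvs_of h => vsproj h (br (vsval x) (vsval y))).

Lemma ad_actionE (hI : is_ideal br h) x y :
  vsval (ad_action x y) = br (vsval x) (vsval y).
Proof.
pose f (y : subvs_of h) := vsproj h (br (vsval x) (vsval y)).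
have fE z : vsval (f z) = br (vsval x) (vsval z).
  by rewrite /f vsprojK ?hI ?subvsP.
have fL : linear f.
  move=> a u v; apply: subvs_inj.
  by rewrite linearP /= !fE linearP lie_linearr.
pose fM := GRing.isLinear.Build F _ _ _ f fL.
pose fl : {linear subvs_of h -> subvs_of h} := HB.pack f fM.
by rewrite /ad_action -/f (lfunE fl) /= fE.
Qed.

End AdjointAction.

Section Notions.
Variables (F : fieldType).

Definition complex_structure (V : vectType F) (br : lie_bracket V)
    (J : 'End(V)) : Prop :=
  (forall x, J (J x) = - x) /\
  (forall x y, br (J x) (J y) = br x y + J (br (J x) y) + J (br x (J y))).

Definition lie_commutator (V : vectType F) (br : lie_bracket V)
    (U W : {vspace V}) : {vspace V} :=
  <<[seq br u w | u <- vbasis U, w <- vbasis W]>>%VS.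

Fixpoint lower_central (V : vectType F) (br : lie_bracket V) (n : nat) :
    {vspace V} :=
  if n is m.+1 then lie_commutator br fullv (lower_central br m) else fullv.

Definition abelian_lie (V : vectType F) (br : lie_bracket V) : Prop :=
  forall x y, br x y = 0.

(* nilpotency class exactly 2; in particular, not abelian *)
Definition two_step_nilpotent (V : vectType F) (br : lie_bracket V) : Prop :=
  lower_central br 2 = 0%VS /\ lower_central br 1 <> 0%VS.

Definition is_derivation (V : vectType F) (br : lie_bracket V)
    (D : 'End(V)) : Prop :=
  forall y z, D (br y z) = br (D y) z + br y (D z).

Definition is_representation (K H : vectType F) (bK : lie_bracket K)
    (pi : K -> 'End(H)) : Prop :=
  linear pi /\
  forall x y, pi (bK x y) = (pi x \o pi y)%VF - (pi y \o pi x)%VF.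

Definition is_representation_by_derivations (K H : vectType F)
    (bK : lie_bracket K) (bH : lie_bracket H) (pi : K -> 'End(H)) : Prop :=
  is_representation bK pi /\ forall x, is_derivation bH (pi x).

(* Z^1(K, pi) *)
Definition cocycle1 (K H : vectType F) (bK : lie_bracket K)
    (pi : K -> 'End(H)) (j : 'Hom(K, H)) : Prop :=
  forall x y, pi x (j y) - pi y (j x) - j (bK x y) = 0.

(* J (x, y) = (- j^-1 y, j x); for bijective j, j^-1 is the inverse of j *)
Definition induced_from (V : vectType F) (k h : {vspace V}) (J : 'End(V))
    (j : 'Hom(subvs_of k, subvs_of h)) : Prop :=
  forall (x : subvs_of k) (y : subvs_of h),
    J (vsval x + vsval y) = - vsval ((j^-1)%VF y) + vsval (j x).

End Notions.

(* Main.v *)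
Require Import Defs.
From HB Require Import structures.
From mathcomp Require Import all_boot all_algebra.
From mathcomp Require Import reals.
Import GRing.Theory.
Local Open Scope ring_scope.

(** Write h = J k.  For x, y in k split the bracket along g = k + h as
    [x,y] = [x,y]_k + c(x,y), with c(x,y) in h.  Since J h = k and h is an
    ideal, the integrability condition
      [Jx,Jy] = [x,y] + J([Jx,y] + [x,Jy])
    splits along the same decomposition: its h-component says
    [Jx,Jy] = c(x,y), its k-component says J([Jx,y] + [x,Jy]) = - [x,y]_k
    ([integrability_split]).

    The k-component, once J is applied to it, is the cocycle identity for
    j = J|k ([integrable_cocycle]).  By the Jacobi identity,
    pi(x) pi(y) - pi(y) pi(x) - pi([x,y]_k) is the operator ad c(x,y) on h.
    Hence pi is a representation exactly when every c(x,y) is central in h;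
    as every bracket of h is some c(x,y), this forces [h,h] to be central in h
    ([representation_nested_bracket]), so h is abelian or 2-step nilpotent. *)

Section LieCommutator.
Set Implicit Arguments.
Unset Strict Implicit.
Variables (F : fieldType) (V : vectType F) (br : lie_bracket V).

(** The adjoint operator as a linear map, so that centralizers become kernels
    and statements on spans can be tested on generators. *)
Lemma lie_ad_exists u : exists f : 'End(V), forall w, f w = br u w.
Proof.
have fL : linear (br u) by move=> a x y; apply: lie_linearr.
pose fM := GRing.isLinear.Build F _ _ _ (br u) fL.
pose fl : {linear V -> V} := HB.pack (br u : V -> V) fM.
by exists (linfun fl) => w; rewrite lfunE.
Qed.

Lemma lie_commutator_sub (U W Z : {vspace V}) :
  (forall u w, br u w \in Z) -> (lie_commutator br U W <= Z)%VS.
Proof.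
by move=> brZ; apply/span_subvP => _ /allpairsP[[u w] [_ _ ->]]; apply: brZ.
Qed.

(** The commutator is generated by brackets of basis vectors only; bilinearity
    reaches all brackets, one argument at a time. *)
Lemma mem_lie_commutator (U W : {vspace V}) u w :
  u \in U -> w \in W -> br u w \in lie_commutator br U W.
Proof.
set L := lie_commutator br U W.
have on_basis (X : {vspace V}) (f : 'End(V)) x :
    {in vbasis X, forall y, f y \in L} -> x \in X -> f x \in L.
  move=> fX; rewrite memv_preim; apply: subvP.
  rewrite -(span_basis (vbasisP X)); apply/span_subvP => y yX.
  by rewrite -memv_preim fX.
move=> uU wW; rewrite lieN memvN.
have [adw adwE] := lie_ad_exists w; rewrite -adwE.
apply: (on_basis U) uU => u' u'U; rewrite adwE lieN memvN.
have [adu aduE] := lie_ad_exists u'; rewrite -aduE.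
apply: (on_basis W) wW => w' w'W; rewrite aduE.
by apply/memv_span/allpairsP; exists (u', w').
Qed.

Lemma nested_bracket_two_step_or_abelian :
  (forall x y z, br x (br y z) = 0) -> two_step_nilpotent br \/ abelian_lie br.
Proof.
move=> br2; have [L1_0|L1_n0] := eqVneq (lower_central br 1) 0%VS.
  right=> x y; apply/eqP; rewrite -memv0 -L1_0.
  by apply: mem_lie_commutator; apply: memvf.
left; split; last exact/eqP.
have L1_central u w : w \in lower_central br 1 -> br u w = 0.
  move=> wL1; have [adu aduE] := lie_ad_exists u.
  apply/eqP; rewrite -aduE -memv_ker; apply: subvP wL1.
  by apply: lie_commutator_sub => x y; rewrite memv_ker aduE br2.
apply/eqP; rewrite -subv0; apply/span_subvP => _ /allpairsP[[u w] [_ wL1 ->]].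
by rewrite memv0 L1_central // (vbasis_mem wL1).
Qed.

End LieCommutator.

Section ComplexDecomposition.
Set Implicit Arguments.
Unset Strict Implicit.
Variables (F : fieldType) (g : vectType F) (br : lie_bracket g).
Variables (J : 'End(g)) (hJ : complex_structure br J) (k : {vspace g}).
Let h := (J @: k)%VS.
Hypotheses (hdec : direct_decomposition k h) (hideal : is_ideal br h).
Let brk := compl_bracket hdec hideal.
Let JJ x : J (J x) = - x := hJ.1 x.

Lemma complex_image_mem y : y \in h -> J y \in k.
Proof. by case/memv_imgP => x kx ->; rewrite JJ memvN. Qed.

(** The difference d of the two sides of the first equation lies in h because
    h is an ideal, and integrability rewrites it as the difference of the two
    sides of the second, which lies in k because J h = k; so d = 0. *)
Lemma integrability_split (x y : subvs_of k) :
  let X := vsval x in let Y := vsval y in let B := vsval (brk x y) in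
  br (J X) (J Y) = br X Y - B /\ J (br (J X) Y + br X (J Y)) = - B.
Proof.
move=> X Y B.
have JXh : J X \in h by rewrite memv_img ?subvsP.
have JYh : J Y \in h by rewrite memv_img ?subvsP.
have ch : br X Y - B \in h by apply/vquot_eqP; rewrite compl_bracketE.
pose d := br (J X) (J Y) - (br X Y - B).
have dE : d = J (br (J X) Y + br X (J Y)) + B.
  rewrite /d hJ.2 (linearD J) opprB -[br X Y + _ + _]addrA.
  by rewrite [LHS]addrC [LHS]addrA subrK addrC.
have d0 : d = 0.
  apply/eqP; rewrite -memv0 -(directv_addP hdec.2) memv_cap; apply/andP; split.
    rewrite dE rpredD ?subvsP // complex_image_mem //.
    by apply: rpredD; [apply: ideal_subl | apply: hideal].
  by rewrite /d rpredB ?hideal.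
by split; apply/eqP; [rewrite -subr_eq0 -/d d0 | rewrite -addr_eq0 -dE d0].
Qed.

Definition complex_restriction : 'Hom(subvs_of k, subvs_of h) :=
  (linfun (vsproj h) \o (J \o linfun vsval))%VF.
Local Notation j := complex_restriction.

Lemma complex_restrictionE x : vsval (j x) = J (vsval x).
Proof. by rewrite !lfunE /= !lfunE /= lfunE /= vsprojK ?memv_img ?subvsP. Qed.

Lemma complex_image_lift (u : subvs_of h) :
  exists x : subvs_of k, vsval u = J (vsval x).
Proof.
have /memv_imgP[x kx ux] := subvsP u.
by exists (vsproj k x); rewrite vsprojK.
Qed.

Lemma complex_restriction_inj : injective j.
Proof.
move=> x y /(congr1 vsval); rewrite !complex_restrictionE => /(congr1 J).
by rewrite !JJ => /oppr_inj/subvs_inj.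
Qed.

Lemma complex_restriction_bij : bijective j.
Proof.
exists (fun u => vsproj k (- J (vsval u))) => [x|u]; apply: subvs_inj.
  by rewrite complex_restrictionE JJ opprK vsprojK ?subvsP.
rewrite complex_restrictionE vsprojK ?memvN ?complex_image_mem ?subvsP //.
by rewrite linearN /= JJ opprK.
Qed.

Lemma complex_restriction_induced : induced_from J j.
Proof.
have ker0 : lker j == 0%VS by apply/lker0P; apply: complex_restriction_inj.
move=> x y; rewrite linearD /= -complex_restrictionE addrC; congr (_ + _).
have [z yz] := complex_image_lift y.
have -> : y = j z by apply: subvs_inj; rewrite complex_restrictionE.
by rewrite lker0_lfunK // complex_restrictionE JJ.
Qed.

(** J applied to the k-component of integrability gives
    j [x,y]_k = [Jx,y] + [x,Jy], which is the cocycle identity. *)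
Lemma integrable_cocycle : cocycle1 brk (@ad_action F g br k h) j.
Proof.
move=> x y; apply/eqP; rewrite subr_eq0; apply/eqP/subvs_inj.
have jB : vsval (j (brk x y)) =
    br (J (vsval x)) (vsval y) + br (vsval x) (J (vsval y)).
  apply: oppr_inj; rewrite complex_restrictionE -[RHS]JJ.
  by rewrite (integrability_split x y).2 linearN.
rewrite jB linearB /= !ad_actionE // !complex_restrictionE.
by rewrite [br (vsval y) _]lieN opprK addrC.
Qed.

(** Elements of h are lifted to k through J; the innermost bracket
    then becomes c(x,y), which ad sees as the defect of pi from being a
    representation. *)
Lemma representation_nested_bracket :
  is_representation brk (@ad_action F g br k h) ->
  forall w u v, ideal_bracket hideal w (ideal_bracket hideal u v) = 0.
Proof.
case=> _ piB w u v; apply: subvs_inj; rewrite !(ideal_opE hideal).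
have [x ->] := complex_image_lift u; have [y ->] := complex_image_lift v.
rewrite (integrability_split x y).1 lieN lieBl.
have := congr1 (fun f : 'End(subvs_of h) => vsval (f w)) (piB x y).
rewrite add_lfunE opp_lfunE !comp_lfunE linearB /= !ad_actionE // => ->.
have := lie_jacobi br (vsval x) (vsval y) (vsval w).
rewrite (lieN br (vsval w) (vsval x)) lieNr (lieN br (vsval w)) => /eqP.
by rewrite subr_eq0 => /eqP ->; rewrite subrr oppr0.
Qed.

End ComplexDecomposition.

Theorem theorem3p7 (R : realType) (g : vectType R) (br : lie_bracket g)
    (J : 'End(g)) (hJ : complex_structure br J)
    (k : {vspace g})
    (hdec : direct_decomposition k (J @: k)%VS)
    (hideal : is_ideal br (J @: k)%VS) :
  let h := (J @: k)%VS in
  let brk : lie_bracket (subvs_of k) := compl_bracket hdec hideal in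
  let brh : lie_bracket (subvs_of h) := ideal_bracket hideal in
  let pi : subvs_of k -> 'End(subvs_of h) := @ad_action R g br k h in
  is_representation_by_derivations brk brh pi ->
  (two_step_nilpotent brh \/ abelian_lie brh) /\
  exists j : 'Hom(subvs_of k, subvs_of h),
    cocycle1 brk pi j /\ bijective j /\ induced_from J j.
Proof.
move=> h brk brh pi [piR _]; split.
  apply: nested_bracket_two_step_or_abelian.
  exact: (representation_nested_bracket hJ piR).
exists (complex_restriction J k); split.
  exact: integrable_cocycle.
split; first exact: (complex_restriction_bij hJ).
exact: (complex_restriction_induced hJ).
Qed.
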